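(* Let $\mathcal U$ be a topological space, let $R:\mathcal U\to\mathcal U$ be a map with iterates $R_n$, $n\ge 0$, let $k(z,w)$ be a positive definite function on $\mathcal U$, and let $(e_j)_{j\in J}$ be an orthonormal basis of $\mathcal H(k)$. Assume that there is a function $K:\mathcal U\times\mathcal U\to\mathbb C$, continuous and not identically equal to $0$ (and not assumed positive definite), such that $$K(z,w)=k(z,w)\,K(R(z),R(w)),\quad\forall z,w\in\mathcal U.$$ Assume also that there exists a point $\ell\in\mathcal U$ such that $\lim_{n\to\infty}R_n(z)=\ell$ for all $z\in\mathcal U$. If $K(\ell,\ell)>0$, then $K(z,w)$ is positive definite in $\mathcal U$ and, for all $z,w\in\mathcal U$, $$K(z,w)=\left(\prod_{n=0}^\infty\left(\sum_{j\in J}e_j(R_n(z))\,e_j(R_n(w))^*\right)\right)K(\ell,\ell).$$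
   Context: For a complex number $c$, $c^*$ denotes its complex conjugate. A function $k:\mathcal U\times\mathcal U\to\mathbb C$ is positive definite on $\mathcal U$ if $\sum_{p,q=1}^M c_p^*\,k(w_p,w_q)\,c_q\ge 0$ for all $M\in\mathbb N$, $w_1,\dots,w_M\in\mathcal U$, $c_1,\dots,c_M\in\mathbb C$. $\mathcal H(k)$ denotes the associated reproducing kernel Hilbert space of functions on $\mathcal U$; for any orthonormal basis $(e_j)_{j\in J}$ of it (the index set $J$ need not be countable), $k(z,w)=\sum_{j\in J}e_j(z)e_j(w)^*$. The iterates are $R_0(z)=z$ and $R_n=R\circ\cdots\circ R$ ($n$ times). Convergence of the infinite product means convergence of the partial products $\prod_{n=0}^N$ as $N\to\infty$. *)

(* Defs.v *)
From HB Require Import structures.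
From mathcomp Require Import all_boot all_order all_algebra finmap.
From mathcomp Require Import all_classical all_reals all_analysis.
From mathcomp Require Import complex.
From mathcomp Require summability.

Set Implicit Arguments.
Unset Strict Implicit.
Unset Printing Implicit Defensive.

Import Order.TTheory GRing.Theory Num.Theory.
Import numFieldNormedType.Exports.

Local Open Scope classical_set_scope.
Local Open Scope ring_scope.

(* The library puts a norm topology on [R[i]^o] only; transfer it to [R[i]]. *)
HB.instance Definition _ (R : realType) := NormedModule.copy R[i] R[i]^o.

(* Inequalities in [R[i]] are the partial order of a [numClosedFieldType]:
   [0 <= x] says that [x] is real and nonnegative. *)
Definition positive_definite (R : realType) (U : Type)
    (k : U -> U -> R[i]) : Prop :=
  forall (M : nat) (w : 'I_M -> U) (c : 'I_M -> R[i]),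
    0 <= \sum_(p < M) \sum_(q < M) (c p)^* * k (w p) (w q) * c q.

Section InnerProduct.
Variables (R : realType) (H : lmodType R[i]) (ip : {dot H for Num.conj}).

(* [ip] is linear in its first argument and conjugate-linear in its second.
   [ip_norm f] has type [R[i]] but is a nonnegative real. *)
Definition ip_norm (f : H) : R[i] := sqrtC (ip f f).

Definition ip_complete : Prop :=
  forall u : nat -> H,
    (forall eps : R[i], 0 < eps -> exists N : nat, forall m n : nat,
       (N <= m)%N -> (N <= n)%N -> ip_norm (u m - u n) < eps) ->
    exists f : H, forall eps : R[i], 0 < eps -> exists N : nat,
      forall n : nat, (N <= n)%N -> ip_norm (u n - f) < eps.

(* An orthonormal family whose linear span is dense. *)
Definition orthonormal_basis (J : choiceType) (e : J -> H) : Prop :=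
  (forall i j : J, ip (e i) (e j) = (i == j)%:R) /\
  (forall (f : H) (eps : R[i]), 0 < eps ->
     exists (A : {fset J}) (c : J -> R[i]),
       ip_norm (f - \sum_(j <- A) c j *: e j) < eps).

End InnerProduct.

(* [H] is a linear space of functions [U -> R[i]] (those satisfying [P]), and
   [val f] is the function underlying [f : H].  By the Moore-Aronszajn theorem
   the predicate below determines the set of functions and the inner product
   from [k]. *)
Record is_rkhs (R : realType) (U : Type) (k : U -> U -> R[i])
    (P : {pred (U -> R[i])}) (H : subLmodType P)
    (ip : {dot H for Num.conj}) : Prop := IsRKHS {
  rkhs_complete : ip_complete ip;
  rkhs_reproducing : forall w : U, exists kw : H,
    val kw = (fun z => k z w) /\ forall f : H, val f w = ip f kw }.

(* Main.v *)
Require Import Defs.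
From HB Require Import structures.
From mathcomp Require Import all_boot all_order all_algebra finmap.
From mathcomp Require Import all_classical all_reals all_analysis.
From mathcomp Require Import complex.
From mathcomp Require summability.

Set Implicit Arguments.
Unset Strict Implicit.
Unset Printing Implicit Defensive.

Import Order.TTheory GRing.Theory Num.Theory.
Import numFieldNormedType.Exports.

Local Open Scope classical_set_scope.
Local Open Scope ring_scope.

(** Write [z_n] for [iter n rho z].  The functional equation of [K], applied
    [N] times, reads
      K(z, w) = (prod_(n < N) k(z_n, w_n)) * K(z_N, w_N).
    Since [z_N] and [w_N] tend to [l] and [K] is continuous at [(l, l)],
    the last factor tends to [K l l], which is not [0]; hence the partial
    products converge, to [K z w / K l l].  This is [cocycle_iter],
    [iter_cvg_pair] and [cvg_cofactor].

    That the factor [k(z, w)] is the sum of [e_j(z) e_j(w)^*] is the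
    reproducing property: [k(z, w) = <k_w, k_z>], where [k_w] and [k_z] have
    coefficients [e_j(w)^*] and [e_j(z)^*] on the basis, so that the expansion
    is Parseval's identity for these two vectors ([parseval],
    [rkhs_kernel_expansion]).  The index set is arbitrary, and the sum is a
    limit along the finite subsets of [J] ordered by inclusion.

    The expansion also yields the Schur product theorem: multiplying a
    positive definite [G] by the rank one kernel [a(z) a(w)^*] only changes the
    coefficients [c_p] of the quadratic form into [c_p a(w_p)^*], and positive
    definiteness survives finite sums and pointwise limits, so [k * G] is
    positive definite ([positive_definite_schur]).  Therefore every partial
    product times [K l l] is positive definite, and so is their limit [K]. *)

#[local] Existing Instance summability.totally_filter.

(** * Fourier expansion on an orthonormal basis *)

(** Pythagoras for the orthogonal projection of [u] on the line of [v]. *)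
Lemma ip_cauchy_schwarz (R : realType) (H : lmodType R[i])
    (ip : {dot H for Num.conj}) (u v : H) :
  `|ip u v| <= ip_norm ip u * ip_norm ip v.
Proof.
rewrite -(@ler_pXn2r _ 2) ?nnegrE ?mulr_ge0 ?sqrtC_ge0 ?dnorm_ge0 //.
rewrite exprMn !sqrtCK.
have [->|v0] := eqVneq v 0.
  by rewrite linear0r normr0 expr0n mulr_ge0 ?dnorm_ge0.
have vv : 0 < ip v v by rewrite dnorm_gt0.
set a := ip u v / ip v v.
have orth : ip (u - a *: v) v = 0.
  by rewrite linearBl linearZl_LR /= /a divfK ?gt_eqF // subrr.
have -> : ip u u = ip (u - a *: v) (u - a *: v) + ip (a *: v) (a *: v).
  by rewrite -hnormDd ?subrK // linearZr_LR /= orth mulr0.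
rewrite (dnormZ ip a v) mulrDl -mulrA -expr2.
have -> : `|ip u v| ^+ 2 = `|a| ^+ 2 * ip v v ^+ 2.
  by rewrite -(ger0_norm (ltW vv)) -exprMn -normrM /a divfK ?gt_eqF.
by rewrite lerDr mulr_ge0 ?dnorm_ge0 // ltW.
Qed.

(** The orthogonal projection on a span is the closest point of the span.
    The competitor may use fewer vectors than the projection: this is what
    turns one good approximation into convergence along all larger index
    sets. *)
Lemma orthonormal_best_approx (R : realType) (H : lmodType R[i])
    (ip : {dot H for Num.conj}) (J : choiceType) (e : J -> H)
    (he : forall i j : J, ip (e i) (e j) = (i == j)%:R)
    (f : H) (A B : {fset J}) (c : J -> R[i]) : (A `<=` B)%fset ->
  ip_norm ip (f - \sum_(j <- B) ip f (e j) *: e j) <=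
  ip_norm ip (f - \sum_(j <- A) c j *: e j).
Proof.
move=> AB; set d := f - \sum_(j <- B) _; set d' := f - _.
have dorth j : j \in B -> ip d (e j) = 0.
  move=> jB; rewrite linearBl linear_sumlz (big_fsetD1 j) //= linearZl_LR /=.
  rewrite he eqxx mulr1 big_seq big1 ?addr0 ?subrr // => i.
  by rewrite !inE => /andP[/negPf ij _]; rewrite linearZl_LR /= he ij mulr0.
have dspan (E : {fset J}) (b : J -> R[i]) : (E `<=` B)%fset ->
    ip d (\sum_(j <- E) b j *: e j) = 0.
  move=> /fsubsetP EB; rewrite linear_sumr big_seq big1 // => j /EB jB.
  by rewrite linearZr_LR /= dorth // mulr0.
pose r := \sum_(j <- B) ip f (e j) *: e j - \sum_(j <- A) c j *: e j.
have d'E : d' = d + r by rewrite /d' /d /r addrA subrK.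
have dr : ip d r = 0 by rewrite linearBr /= !dspan ?subrr.
have nE : ip (d + r) (d + r) = ip d d + ip r r by exact: hnormDd.
rewrite /ip_norm -/d' d'E ler_sqrtC ?nE ?nnegrE ?addr_ge0 ?dnorm_ge0 //.
by rewrite lerDl dnorm_ge0.
Qed.

(** With [d] the remainder of the Fourier expansion of [f] over [B], the error
    of the partial sum over [B] is exactly [ip d g].  It is bounded by
    Cauchy-Schwarz, and [ip_norm ip d] is small as soon as [B] contains the
    support of a good approximation of [f]. *)
Lemma parseval (R : realType) (H : lmodType R[i])
    (ip : {dot H for Num.conj}) (J : choiceType) (e : J -> H)
    (he : orthonormal_basis ip e) (f g : H) :
  summability.partial_sum (fun j => ip f (e j) * ip (e j) g) A
    @[A --> summability.totally] --> ip f g.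
Proof.
case: he => orth dense.
apply/cvgrPdist_lt => eps eps0.
(* The summand [1] avoids dividing by [0] when [g = 0]. *)
have n1 : 0 < 1 + ip_norm ip g by rewrite ltr_pwDl ?sqrtC_ge0 ?dnorm_ge0.
have [A [c Ac]] := dense f (eps / (1 + ip_norm ip g)) (divr_gt0 eps0 n1).
exists A => // B /= AB.
set d := f - \sum_(j <- B) ip f (e j) *: e j.
have -> : summability.partial_sum (fun j => ip f (e j) * ip (e j) g) B
    = \sum_(j <- B) ip f (e j) * ip (e j) g.
  by rewrite /summability.partial_sum big_seq_fsetE.
have -> : ip f g - \sum_(j <- B) ip f (e j) * ip (e j) g = ip d g.
  rewrite linearBl linear_sumlz; congr (_ - _).
  by apply: eq_bigr => j _; rewrite linearZl_LR.
apply: (le_lt_trans (ip_cauchy_schwarz ip d g)).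
apply: (@le_lt_trans _ _ (ip_norm ip d * (1 + ip_norm ip g))).
  by rewrite ler_wpM2l ?sqrtC_ge0 ?dnorm_ge0 // lerDr.
rewrite -ltr_pdivlMr //.
exact: le_lt_trans (orthonormal_best_approx orth f c AB) Ac.
Qed.

(** Parseval's identity for [k z w = ip kw kz], where [kz] and [kw] are the
    vectors representing the evaluations at [z] and [w]. *)
Lemma rkhs_kernel_expansion (R : realType) (U : Type) (k : U -> U -> R[i])
    (P : {pred (U -> R[i])}) (H : subLmodType P)
    (ip : {dot H for Num.conj}) (hH : is_rkhs k ip)
    (J : choiceType) (e : J -> H) (he : orthonormal_basis ip e) (z w : U) :
  summability.partial_sum (fun j => val (e j) z * (val (e j) w)^*) A
    @[A --> summability.totally] --> k z w.
Proof.
have [kz [_ repz]] := rkhs_reproducing hH z.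
have [kw [kwE repw]] := rkhs_reproducing hH w.
have -> : k z w = ip kw kz by rewrite -repz kwE.
have -> : (fun j => val (e j) z * (val (e j) w)^*) =
          (fun j => ip kw (e j) * ip (e j) kz).
  apply/funext => j; rewrite mulrC repz repw; congr (_ * _).
  by rewrite (hermC ip kw) expr0 mul1r.
exact: parseval.
Qed.

(** * Positive definite kernels *)

(** Being nonnegative means being equal to one's norm, which is a closed
    condition even when the order of [C] is partial, as for complex numbers. *)
Lemma cvg_ge0 (C : numFieldType) (T : Type) (F : set_system T)
    {FF : ProperFilter F} (u : T -> C) (a : C) :
  (forall t, 0 <= u t) -> u t @[t --> F] --> a -> 0 <= a.
Proof.
move=> u0 ua; rewrite (_ : a = `|a|) ?normr_ge0 //.
apply: (cvg_unique _ ua); first exact: norm_hausdorff.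
rewrite (_ : u = fun t => `|u t|); first exact: cvg_norm.
by apply/funext => t; rewrite ger0_norm.
Qed.

Lemma positive_definite_cvg (R : realType) (U T : Type) (F : set_system T)
    {FF : ProperFilter F} (G : T -> U -> U -> R[i]) (L : U -> U -> R[i]) :
  (forall t, positive_definite (G t)) ->
  (forall z w, G t z w @[t --> F] --> L z w) ->
  positive_definite L.
Proof.
move=> Gpd GL M w c.
apply: (@cvg_ge0 _ _ F _
  (fun t => \sum_(p < M) \sum_(q < M) (c p)^* * G t (w p) (w q) * c q)).
  by move=> t; exact: Gpd.
apply: cvg_big => [|p _]; first exact: add_continuous.
apply: cvg_big => [|q _]; first exact: add_continuous.
by apply: cvgM; [apply: cvgM => //; exact: cvg_cst | exact: cvg_cst].
Qed.

Lemma positive_definite_sum (R : realType) (U : Type) (I : finType)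
    (G : I -> U -> U -> R[i]) :
  (forall i, positive_definite (G i)) ->
  positive_definite (fun z w => \sum_i G i z w).
Proof.
move=> Gpd M w c.
rewrite (_ : \sum_p _ =
  \sum_i \sum_(p < M) \sum_(q < M) (c p)^* * G i (w p) (w q) * c q).
  by apply: sumr_ge0 => i _; exact: Gpd.
rewrite [RHS]exchange_big /=; apply: eq_bigr => p _.
rewrite [RHS]exchange_big /=; apply: eq_bigr => q _.
by rewrite mulr_sumr mulr_suml.
Qed.

(** The factor [a] is absorbed by the coefficients of the quadratic form, [c p]
    becoming [c p * (a (w p))^*]. *)
Lemma positive_definite_twist (R : realType) (U : Type) (a : U -> R[i])
    (G : U -> U -> R[i]) : positive_definite G ->
  positive_definite (fun z w => a z * (a w)^* * G z w).
Proof.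
move=> Gpd M w c.
rewrite (_ : \sum_p _ = \sum_(p < M) \sum_(q < M)
  (c p * (a (w p))^*)^* * G (w p) (w q) * (c q * (a (w q))^*)).
  exact: Gpd.
apply: eq_bigr => p _; apply: eq_bigr => q _.
rewrite rmorphM /= conjCK -!mulrA; congr (_ * (_ * _)).
by rewrite mulrC -!mulrA; congr (_ * _).
Qed.

Lemma positive_definite_cst (R : realType) (U : Type) (a : R[i]) :
  0 <= a -> positive_definite (fun _ _ : U => a).
Proof.
move=> a0 M w c.
rewrite (_ : \sum_p _ = a * `|\sum_p c p| ^+ 2).
  by rewrite mulr_ge0 // exprn_ge0.
rewrite normCKC rmorph_sum /= mulrCA mulr_suml; apply: eq_bigr => p _.
by rewrite !mulr_sumr; apply: eq_bigr => q _; rewrite mulrA.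
Qed.

(** The Schur product theorem: along the finite subsets of [J], the product is
    a limit of finite sums of twists of [G] by the functions [a j]. *)
Lemma positive_definite_schur (R : realType) (U : Type) (J : choiceType)
    (a : J -> U -> R[i]) (k G : U -> U -> R[i]) :
  (forall z w,
     summability.partial_sum (fun j => a j z * (a j w)^*) A
       @[A --> summability.totally] --> k z w) ->
  positive_definite G -> positive_definite (fun z w => k z w * G z w).
Proof.
move=> ak Gpd.
apply: (@positive_definite_cvg _ _ _ summability.totally _ (fun A z w =>
  \sum_(j : A) (a (val j) z * (a (val j) w)^* * G z w))).
  move=> A; apply: positive_definite_sum => j.
  exact: positive_definite_twist.
move=> z w.
rewrite (_ : (fun A : {fset J} => _) = (fun A =>
  summability.partial_sum (fun j => a j z * (a j w)^*) A * G z w)).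
  by apply: cvgM; [exact: ak | exact: cvg_cst].
by apply/funext => A; rewrite /summability.partial_sum mulr_suml.
Qed.

(** * Iterating the functional equation *)

Lemma cocycle_iter (C : comNzRingType) (U : Type) (rho : U -> U)
    (k K : U -> U -> C)
    (hK : forall z w, K z w = k z w * K (rho z) (rho w)) (N : nat) (z w : U) :
  K z w = (\prod_(n < N) k (iter n rho z) (iter n rho w)) *
          K (iter N rho z) (iter N rho w).
Proof.
elim: N => [|N IH]; first by rewrite big_ord0 mul1r.
by rewrite big_ord_recr /= -mulrA -hK.
Qed.

Lemma iter_cvg_pair (T V : topologicalType) (rho : T -> T)
    (K : T -> T -> V) (l : T) :
  continuous (fun p : T * T => K p.1 p.2) ->
  (forall z : T, iter n rho z @[n --> \oo] --> l) ->
  forall z w : T, K (iter n rho z) (iter n rho w) @[n --> \oo] --> K l l.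
Proof.
move=> Kcont hl z w.
apply: (@cvg_comp _ _ _ (fun n => (iter n rho z, iter n rho w))
  (fun p : T * T => K p.1 p.2) _ (nbhs (l, l))); last exact: (Kcont (l, l)).
exact: cvg_pair (hl z) (hl w).
Qed.

(** In [x = p * q], the factor [p] is determined by [q] wherever [q] does not
    vanish, which is eventually the case when the limit of [q] is not [0]. *)
Lemma cvg_cofactor (C : numFieldType) (T : Type) (F : set_system T)
    {FF : Filter F} (p q : T -> C) (x y : C) :
  y != 0 -> (forall t, x = p t * q t) -> q t @[t --> F] --> y ->
  p t @[t --> F] --> x / y.
Proof.
move=> y0 pq qy.
have qy' : x * (q t)^-1 @[t --> F] --> x / y.
  by apply: cvgM; [exact: cvg_cst | exact: cvgV].
apply: cvg_trans qy'; apply: near_eq_cvg.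
near=> t; rewrite /= (pq t) mulfK //; near: t.
exact: (cvgr_neq0 y qy y0).
Unshelve. all: by end_near.
Qed.

Theorem proposition3p1 (R : realType) (U : topologicalType) (rho : U -> U)
    (k : U -> U -> R[i]) (hk : positive_definite k)
    (P : {pred (U -> R[i])}) (H : subLmodType P)
    (ip : {dot H for Num.conj}) (hH : is_rkhs k ip)
    (J : choiceType) (e : J -> H) (he : orthonormal_basis ip e)
    (K : U -> U -> R[i])
    (hKcont : continuous (fun p : U * U => K p.1 p.2))
    (hK0 : ~ (forall z w : U, K z w = 0))
    (hK : forall z w : U, K z w = k z w * K (rho z) (rho w))
    (l : U) (hl : forall z : U, iter n rho z @[n --> \oo] --> l)
    (hKl : 0 < K l l) :
  let summand (n : nat) (z w : U) (j : J) : R[i] :=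
    val (e j) (iter n rho z) * (val (e j) (iter n rho w))^* in
  let partial_prod (N : nat) (z w : U) : R[i] :=
    \prod_(n < N.+1) summability.sum (summand n z w) in
  positive_definite K /\
  (forall z w : U,
     (forall n : nat,
        cvg (summability.partial_sum (summand n z w) @ summability.totally)) /\
     cvg (partial_prod N z w @[N --> \oo]) /\
     K z w = lim (partial_prod N z w @[N --> \oo]) * K l l).
Proof.
move=> summand partial_prod.
have Kl0 : K l l != 0 by rewrite gt_eqF.
have expand n z w : summability.partial_sum (summand n z w)
    @ summability.totally --> k (iter n rho z) (iter n rho w).
  exact: (rkhs_kernel_expansion hH he).
have partial_prodE N z w : partial_prod N z w =
    \prod_(n < N.+1) k (iter n rho z) (iter n rho w).
  apply: eq_bigr => n _; apply: cvg_lim; first exact: norm_hausdorff.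
  exact: expand.
have prod_cvg z w : partial_prod N z w @[N --> \oo] --> K z w / K l l.
  apply: (@cvg_cofactor _ _ _ _ _
    (fun N => K (iter N.+1 rho z) (iter N.+1 rho w))) => //.
    by move=> N; rewrite partial_prodE; exact: cocycle_iter.
  (* The partial product of index [N] has [N.+1] factors. *)
  have := iter_cvg_pair hKcont hl (rho z) (rho w).
  by under eq_fun do rewrite -!iterSr.
have prod_pd N :
    positive_definite (fun z w => partial_prod N z w * K l l).
  rewrite (_ : (fun z w => _) = fun z w =>
    (\prod_(n < N.+1) k (iter n rho z) (iter n rho w)) * K l l); last first.
    by apply/funext => z; apply/funext => w; rewrite partial_prodE.
  elim: N.+1 => {N} [|N IH].
    under eq_fun do under eq_fun do rewrite big_ord0 mul1r.
    by apply: positive_definite_cst; exact: ltW.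
  rewrite (_ : (fun z w => _) = fun z w => k (iter N rho z) (iter N rho w) *
    (\prod_(n < N) k (iter n rho z) (iter n rho w) * K l l)); last first.
    apply/funext => z; apply/funext => w.
    by rewrite big_ord_recr /= mulrAC mulrC.
  apply: (positive_definite_schur (a := fun j z => val (e j) (iter N rho z))
    _ IH) => z w.
  exact: expand.
split; last first.
  move=> z w; split; first by move=> n; exact: cvgP (expand n z w).
  split; first exact: cvgP (prod_cvg z w).
  by rewrite (cvg_lim (@norm_hausdorff _ _) (prod_cvg z w)) divfK.
apply: (positive_definite_cvg (F := \oo) prod_pd) => z w.
rewrite -[K z w](divfK Kl0).
by apply: cvgM; [exact: prod_cvg | exact: cvg_cst].
Qed.
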